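(* Let $\mathfrak C$ be a left cancellative small category. The canonical projection $I_l\ltimes\partial\Omega\twoheadrightarrow I_l\,\bar\ltimes\,\partial\Omega$ is an isomorphism (of topological groupoids) if one of the following holds: (i) The canonical projection $I_l\ltimes\Omega\twoheadrightarrow I_l\,\bar\ltimes\,\Omega$ is an isomorphism. (ii) $I_l\ltimes\partial\Omega$ is Hausdorff. (iii) $\partial\Omega=\Omega_{\max}$.
   Context: $\mathfrak C$ denotes the set of morphisms, $\mathfrak C^0\subseteq\mathfrak C$ the identity morphisms, $\mathfrak d,\mathfrak t$ domain and target; $cd$ is defined iff $\mathfrak d(c)=\mathfrak t(d)$; left cancellative means $cx=cy\Rightarrow x=y$. Each $c\in\mathfrak C$ gives the partial bijection $\mathfrak d(c)\mathfrak C\to c\mathfrak C$, $x\mapsto cx$; $I_l$ is the smallest semigroup of partial bijections of $\mathfrak C$ containing these and closed under inverses; $\mathcal J=\{\mathrm{dom}(s):s\in I_l\}$ is its semilattice of idempotents (product = intersection). $\bar{\mathcal J}$ is the set of subsets $\varepsilon=e\setminus\bigcup_{i=1}^nf_i$ with $e,f_i\in\mathcal J$, $f_i\subseteq e$. $\widehat{\mathcal J}$ is the space of non-zero multiplicative maps $\chi:\mathcal J\to\{0,1\}$ with $\chi(\emptyset)=0$ if $\emptyset\in\mathcal J$ (pointwise convergence). $\Omega\subseteq\widehat{\mathcal J}$ consists of those $\chi$ such that whenever $e=\bigcup_{i=1}^nf_i$ ($e,f_i\in\mathcal J$) and $\chi(e)=1$, then $\chi(f_i)=1$ for some $i$. $\Omega_{\max}\subseteq\Omega$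 is the set of $\chi\in\widehat{\mathcal J}$ with $\chi^{-1}(1)$ maximal, and $\partial\Omega=\overline{\Omega_{\max}}$. For $\chi\in\Omega$, $\varepsilon=e\setminus\bigcup f_i\in\bar{\mathcal J}$, put $\chi(\varepsilon)=1$ iff $\chi(e)=1$ and all $\chi(f_i)=0$, and $\chi(\varepsilon)=0$ otherwise. $s\in I_l$ acts by $\chi\mapsto s.\chi=\chi(s^{-1}\cdot s)$ from $\{\chi\in\Omega:\chi(s^{-1}s)=1\}$ onto $\{\chi\in\Omega:\chi(ss^{-1})=1\}$; $\partial\Omega$ is invariant. For $Y=\Omega$ or $Y=\partial\Omega$: $I_l\ltimes Y$ is the quotient of $\{(s,\chi)\in I_l\times Y:\chi(s^{-1}s)=1\}$ by $(s,\chi)\sim(t,\psi)$ iff $\chi=\psi$ and $se=te$ for some $e\in\mathcal J$ with $\chi(e)=1$; $I_l\,\bar\ltimes\,Y$ is the quotient by $(s,\chi)\bar\sim(t,\psi)$ iff $\chi=\psi$ and $s\varepsilon=t\varepsilon$ for some $\varepsilon\in\bar{\mathcal J}$ with $\chi(\varepsilon)=1$ (restrictions as partial bijections). Both are groupoids with source $\chi$, range $s.\chi$, $[s,t.\chi][t,\chi]=[st,\chi]$, topologized such that the images of $\{s\}\times\{\chi\in Y:\chi(s^{-1}s)=1\}$ are open and mapped homeomorphically by the source map onto $\{\chi\in Y:\chi(s^{-1}s)=1\}$. The canonical projections send $\sim$-classes to $\bar\sim$-classes. *)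

(* Defs.v *)
From HB Require Import structures.
From mathcomp Require Import all_boot.
From mathcomp Require Import all_classical topology.

Set Implicit Arguments.
Unset Strict Implicit.
Unset Printing Implicit Defensive.

Local Open Scope classical_set_scope.
Local Open Scope quotient_scope.

(** * Left cancellative small categories *)

(* Arrows-only presentation: an object is identified with its identity
   morphism, so that dom and tgt take values in the identity morphisms.
   The product c d is written cmul c d and is meaningful only if
   dom c = tgt d; outside composable pairs cmul is unconstrained, and never
   used below. *)
Record smallCategory := SmallCategory {
  mor :> Type;
  dom : mor -> mor;
  tgt : mor -> mor;
  cmul : mor -> mor -> mor;
  dom_dom : forall c, dom (dom c) = dom c;
  tgt_dom : forall c, tgt (dom c) = dom c;
  dom_tgt : forall c, dom (tgt c) = tgt c;
  tgt_tgt : forall c, tgt (tgt c) = tgt c;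
  cmul_dom : forall c, cmul c (dom c) = c;
  cmul_tgt : forall c, cmul (tgt c) c = c;
  dom_cmul : forall c d, dom c = tgt d -> dom (cmul c d) = dom d;
  tgt_cmul : forall c d, dom c = tgt d -> tgt (cmul c d) = tgt c;
  cmulA : forall b c d, dom b = tgt c -> dom c = tgt d ->
    cmul b (cmul c d) = cmul (cmul b c) d
}.

Definition left_cancellative (C : smallCategory) :=
  forall c x y : C, dom c = tgt x -> dom c = tgt y ->
    cmul c x = cmul c y -> x = y.

Record lcCategory := LcCategory {
  lc_cat :> smallCategory;
  lc_cancel : left_cancellative lc_cat
}.

(** * Partial bijections, represented by their graphs *)

Definition partial_bijection {T : Type} (s : set (T * T)) :=
  (forall x y z, s (x, y) -> s (x, z) -> y = z) /\
  (forall x y z, s (x, z) -> s (y, z) -> x = y).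

Definition pdom {T : Type} (s : set (T * T)) : set T :=
  [set x | exists y, s (x, y)].

(* s t is "t first, then s", which is also the convention of the library's
   composition of relations. *)
Definition pcomp {T : Type} (s t : set (T * T)) : set (T * T) :=
  (s \; t)%relation.

Definition pinv {T : Type} (s : set (T * T)) : set (T * T) :=
  (s^-1)%relation.

(* The product s e of s with the idempotent given by the identity of e. *)
Definition prestr {T : Type} (s : set (T * T)) (e : set T) : set (T * T) :=
  [set p | s p /\ e p.1].

Definition pre {T : Type} (s : set (T * T)) (e : set T) : set T :=
  [set x | exists2 y, s (x, y) & e y].

(** * The semigroup I_l and the semilattice J *)

Section Semigroup.
Variable C : lcCategory.
Implicit Types (s t : set (C * C)) (c x y : C).

(* c C *)
Definition rideal c : set C := [set cmul c x | x in [set x | dom c = tgt x]].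

Definition lmul c : set (C * C) := [set (x, cmul c x) | x in rideal (dom c)].

Definition inv_subsemigroup (M : set (set (C * C))) :=
  (forall s t, M s -> M t -> M (pcomp s t)) /\ (forall s, M s -> M (pinv s)).

Definition Il : set (set (C * C)) := smallest inv_subsemigroup (range lmul).

Definition J : set (set C) := [set pdom s | s in Il].

Lemma rideal_domE c x : rideal (dom c) x <-> dom c = tgt x.
Proof.
split=> [[y /= yE <-]|xE].
  by rewrite tgt_cmul// tgt_dom.
by exists x; rewrite /= ?dom_dom// xE cmul_tgt.
Qed.

Lemma Il_comp s t : Il s -> Il t -> Il (pcomp s t).
Proof.
move=> Is It M MP; have [[Mc _] _] := MP; apply: Mc; [exact: Is|exact: It].
Qed.

Lemma Il_inv s : Il s -> Il (pinv s).
Proof. by move=> Is M MP; have [[_ Mi] _] := MP; apply: Mi; exact: Is. Qed.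

Lemma Il_partial_bijection s : Il s -> partial_bijection s.
Proof.
apply; split; first split.
- move=> u v [u1 u2] [v1 v2]; split=> x y z /=.
    move=> [/= a xa ay] [/= b xb bz]; move: bz.
    by rewrite -(v1 _ _ _ xa xb); exact: (u1 _ _ _ ay).
  move=> [/= a xa az] [/= b yb bz]; move: yb.
  by rewrite -(u2 _ _ _ az bz); exact: (v2 _ _ _ xa).
- by move=> u [u1 u2]; split=> x y z /= ? ?; [apply: u2|apply: u1]; eassumption.
- move=> _ [c _ <-]; split=> x y z /=.
    by move=> [a _ [<- <-]] [b _ [-> <-]].
  move=> [a /rideal_domE ca [<- <-]] [b /rideal_domE cb [<- E]].
  by apply: lc_cancel ca cb _; rewrite E.
Qed.

Lemma pdom_inv_comp s : Il s -> pcomp (pinv s) s = [set p | pdom s p.1 /\ p.1 = p.2].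
Proof.
move=> /Il_partial_bijection [_ s2]; apply/seteqP; split=> [[x y] [/= z xz yz]|].
  by split; [exists z|exact: (s2 _ _ _ xz yz)].
by move=> [x y] [/= [z xz] <-]; exists z.
Qed.

Lemma J_pdom s : Il s -> J (pdom s).
Proof. by move=> Is; exists s. Qed.

Lemma J_pre s (e : set C) : Il s -> J e -> J (pre s e).
Proof.
move=> Is [t It <-]; exists (pcomp t s); first exact: Il_comp.
apply/seteqP; split=> x /=.
  by move=> [z [y xy yz]]; exists y => //; exists z.
by move=> [y xy [z yz]]; exists z; exists y.
Qed.

Lemma J_setI (e f : set C) : J e -> J f -> J (e `&` f).
Proof.
move=> [s Is <-] Jf.
have -> : pdom s `&` f = pre (pcomp (pinv s) s) f.
  rewrite pdom_inv_comp//; apply/seteqP; split=> x /=.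
    by move=> [xs xf]; exists x.
  by move=> [y [/= xs <-] xf].
by apply: J_pre Jf; apply: Il_comp => //; exact: Il_inv.
Qed.

Definition IlM (s t : Il) : Il :=
  SigSub (mem_set (Il_comp (set_valP s) (set_valP t))).

Definition IlV (s : Il) : Il := SigSub (mem_set (Il_inv (set_valP s))).

(* s^-1 s, as an element of J *)
Definition Jdom (s : Il) : J := SigSub (mem_set (J_pdom (set_valP s))).

(* s^-1 e s, as an element of J *)
Definition Jpre (s : Il) (e : J) : J :=
  SigSub (mem_set (J_pre (set_valP s) (set_valP e))).

Definition JI (e f : J) : J :=
  SigSub (mem_set (J_setI (set_valP e) (set_valP f))).

Definition Junion (fs : seq J) : set C := \bigcup_(f in [set` fs]) \val f.

(** * Characters *)

Definition is_character (chi : {ptws J -> bool}) :=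
  [/\ exists e, chi e = true,
      forall e f, chi (JI e f) = chi e && chi f
    & forall e, \val e = set0 -> chi e = false].

Definition spectrum : topologicalType := set_type is_character.

Definition ev (chi : spectrum) (e : J) : bool := \val chi e.

Definition Omega : set spectrum :=
  [set chi | forall (e : J) (fs : seq J), \val e = Junion fs ->
     ev chi e = true -> exists2 f, f \in fs & ev chi f = true].

Definition Omega_max : set spectrum :=
  [set chi | forall psi : spectrum,
     [set e | ev chi e = true] `<=` [set e | ev psi e = true] ->
     [set e | ev chi e = true] = [set e | ev psi e = true]].

Definition dOmega : set spectrum := closure Omega_max.

(** * The sets e \ (f_1 u ... u f_n), n >= 0 *)

Definition Jbar_presentation (eps : set C) (e : J) (fs : seq J) :=
  (forall f, f \in fs -> \val f `<=` \val e) /\ eps = \val e `\` Junion fs.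

Definition Jbar : set (set C) :=
  [set eps | exists e fs, Jbar_presentation eps e fs].

(* By ev_barE below, the choice of the presentation is irrelevant on Omega. *)
Definition ev_bar (chi : spectrum) (eps : set C) : bool :=
  `[< exists e fs, [/\ Jbar_presentation eps e fs, ev chi e = true
                   & forall f, f \in fs -> ev chi f = false] >].

Lemma evI (chi : spectrum) e f : ev chi (JI e f) = ev chi e && ev chi f.
Proof. by have [_ + _] := set_valP chi; exact. Qed.

Lemma Jval_inj (e f : J) : \val e = \val f -> e = f.
Proof. exact: val_inj. Qed.

Lemma ev_sub (chi : spectrum) (e f : J) :
  \val e `<=` \val f -> ev chi e = true -> ev chi f = true.
Proof.
move=> ef che; have : JI e f = e by apply: Jval_inj => /=; exact/setIidl.
by move=> /(congr1 (ev chi)); rewrite evI che.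
Qed.

Lemma ev_barE (chi : spectrum) eps e fs : Omega chi ->
  Jbar_presentation eps e fs ->
  ev_bar chi eps <-> ev chi e = true /\ forall f, f \in fs -> ev chi f = false.
Proof.
move=> Och pr; split; last first.
  by move=> [? ?]; apply/asboolP; exists e, fs; split.
move=> /asboolP[e' [fs' [[_ eps'] che' chfs']]]; have [_ epsE] := pr.
have che : ev chi e = true.
  have /Och/(_ che') : \val e' = Junion (JI e e' :: [seq JI e' f | f <- fs']).
    apply/seteqP; split=> x /=.
      move=> xe'; have [[f ffs' xf]|nx] := pselect (Junion fs' x).
        exists (JI e' f) => //=; rewrite inE; apply/orP; right.
        by apply/mapP; exists f.
      exists (JI e e'); first by rewrite /= inE eqxx.
      split=> //; have : eps x by rewrite eps'.
      by rewrite epsE => -[].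
    move=> [f /=]; rewrite inE => /orP[/eqP->[]//|/mapP[g _ ->] []//].
  move=> [f]; rewrite inE => /orP[/eqP->|/mapP[g gfs ->]]; rewrite evI.
    by case/andP.
  by rewrite (chfs' _ gfs) andbF.
split=> // f ffs; apply/negP => chf.
have : ev chi (JI e' f) = true by rewrite evI che'.
have /Och/[apply] : \val (JI e' f) = Junion [seq JI (JI e' f) g | g <- fs'].
  apply/seteqP; split=> x /=.
    move=> [xe' xf]; have [[g gfs' xg]|nx] := pselect (Junion fs' x).
      by exists (JI (JI e' f) g) => //=; apply/mapP; exists g.
    have : eps x by rewrite eps'.
    by rewrite epsE => -[_ []]; exists f.
  by move=> [g /= /mapP[h _ ->]] [].
by move=> [g /mapP[h hfs ->]]; rewrite !evI (chfs' _ hfs) andbF.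
Qed.

(** * The action of I_l *)

Lemma act_subproof (s : Il) (chi : spectrum) : ev chi (Jdom s) = true ->
  is_character ((fun e => ev chi (Jpre s e)) : {ptws J -> bool}).
Proof.
have [s1 s2] := Il_partial_bijection (set_valP s).
move=> chs; split.
- exists (Jdom (IlV s)); rewrite -chs; congr (ev chi _); apply: Jval_inj.
  apply/seteqP; split=> x /= [y]; first by exists y.
  by exists y => //; exists x.
- move=> e f; rewrite -evI; congr (ev chi _); apply: Jval_inj.
  apply/seteqP; split=> x /=.
    by move=> [y xy [ye yf]]; split; exists y.
  move=> [[y xy ye] [z xz zf]]; exists y => //; split=> //.
  by rewrite (s1 _ _ _ xy xz).
- move=> e e0; have [_ _] := set_valP chi; apply; apply/seteqP; split=> x //=.
  by rewrite e0 => -[].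
Qed.

Definition act (s : Il) (chi : spectrum) (h : ev chi (Jdom s) = true) :
  spectrum := SigSub (mem_set (act_subproof h)).

(** * The groupoids of germs *)

Section Germs.
Variable Y : set spectrum.

(* The pairs (s, chi) with chi in Y and chi(s^-1 s) = 1; the disjoint union
   topology over s is the subspace topology of (discrete I_l) x Y. *)
Definition pairs : topologicalType :=
  {s : Il & set_type (Y `&` [set chi | ev chi (Jdom s) = true])}.

Definition elt (p : pairs) : Il := projT1 p.

Definition base (p : pairs) : spectrum := \val (projT2 p).

Lemma base_dom (p : pairs) : ev (base p) (Jdom (elt p)) = true.
Proof. by have [] := set_valP (projT2 p). Qed.

Definition germ_rel : rel pairs := fun p q =>
  `[< base p = base q /\
      exists e : J,
        prestr (\val (elt p)) (\val e) = prestr (\val (elt q)) (\val e)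
        /\ ev (base p) e = true >].

Definition germbar_rel : rel pairs := fun p q =>
  `[< base p = base q /\
      exists2 eps, Jbar eps &
        prestr (\val (elt p)) eps = prestr (\val (elt q)) eps
        /\ ev_bar (base p) eps = true >].

Lemma prestr_sub s t (e f : set C) : f `<=` e ->
  prestr s e = prestr t e -> prestr s f = prestr t f.
Proof.
by move=> fe /seteqP[st ts]; apply/seteqP; split=> p [p1 pf];
  split=> //; [case: (st p)|case: (ts p)] => //; split=> //; exact: fe.
Qed.

Lemma germ_rel_refl : reflexive germ_rel.
Proof.
by move=> p; apply/asboolP; split=> //; exists (Jdom (elt p)); rewrite base_dom.
Qed.

Lemma germ_rel_sym : symmetric germ_rel.
Proof.
by move=> p q; apply/asbool_equiv_eq; split=> -[E [e [H1 H2]]];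
  (split; [by []|exists e; split; [by []|rewrite -?E// E]]).
Qed.

Lemma germ_rel_trans : transitive germ_rel.
Proof.
move=> q p r /asboolP[pq [e [ste che]]] /asboolP[qr [f [tuf chf]]].
apply/asboolP; split; first by rewrite pq.
exists (JI e f); split; last by rewrite evI che pq chf.
rewrite (prestr_sub _ ste); last exact: subIsetl.
by apply: prestr_sub tuf; exact: subIsetr.
Qed.

Canonical germ_equiv := EquivRel germ_rel germ_rel_refl germ_rel_sym germ_rel_trans.

Lemma Jbar_J (e : J) : Jbar (\val e).
Proof.
exists e, [::]; split=> //; rewrite /Junion.
by rewrite (_ : [set` [::]] = set0) ?bigcup_set0 ?setD0//; apply/seteqP; split.
Qed.

Lemma ev_bar_J (chi : spectrum) (e : J) : ev chi e = true -> ev_bar chi (\val e).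
Proof.
move=> che; apply/asboolP; exists e, [::]; split=> //; split=> //; rewrite /Junion.
by rewrite (_ : [set` [::]] = set0) ?bigcup_set0 ?setD0//; apply/seteqP; split.
Qed.

Lemma ev_barI (chi : spectrum) eps eps' : ev_bar chi eps -> ev_bar chi eps' ->
  Jbar (eps `&` eps') /\ ev_bar chi (eps `&` eps').
Proof.
move=> /asboolP[e [fs [[fe ->] che chf]]] /asboolP[e' [fs' [[fe' ->] che' chf']]].
pose gs := [seq JI f e' | f <- fs] ++ [seq JI e f | f <- fs'].
have P : Jbar_presentation
    ((\val e `\` Junion fs) `&` (\val e' `\` Junion fs')) (JI e e') gs.
  split.
    move=> f; rewrite mem_cat => /orP[]/mapP[g gfs ->].
      by move=> x [/(fe _ gfs)].
    by move=> x [? /(fe' _ gfs)].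
  apply/seteqP; split=> x /=.
    move=> [[xe xf] [xe' xf']]; split=> // -[f /=].
    rewrite mem_cat => /orP[]/mapP[g gfs ->] [xg xg'].
      by apply: xf; exists g.
    by apply: xf'; exists g.
  move=> [[xe xe'] xgs]; split; split=> // -[g /= gfs xg]; apply: xgs.
    exists (JI g e') => //=; rewrite mem_cat; apply/orP; left.
    by apply/mapP; exists g.
  exists (JI e g) => //=; rewrite mem_cat; apply/orP; right.
  by apply/mapP; exists g.
split; first by exists (JI e e'), gs.
apply/asboolP; exists (JI e e'), gs; split=> //; first by rewrite evI che.
by move=> f; rewrite mem_cat => /orP[]/mapP[g gfs ->];
  rewrite evI ?(chf _ gfs)// (chf' _ gfs) andbF.
Qed.

Lemma germbar_rel_refl : reflexive germbar_rel.
Proof.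
move=> p; apply/asboolP; split=> //; exists (\val (Jdom (elt p))).
  exact: Jbar_J.
by split=> //; apply: ev_bar_J; rewrite base_dom.
Qed.

Lemma germbar_rel_sym : symmetric germbar_rel.
Proof.
by move=> p q; apply/asbool_equiv_eq; split=> -[E [e Je [H1 H2]]];
  (split; [by []|exists e => //; split; [by []|rewrite -?E// E]]).
Qed.

Lemma germbar_rel_trans : transitive germbar_rel.
Proof.
move=> q p r /asboolP[pq [e Je [ste che]]] /asboolP[qr [f Jf [tuf chf]]].
apply/asboolP; split; first by rewrite pq.
rewrite -pq in chf; have [Jef chef] := ev_barI che chf.
exists (e `&` f) => //; split=> //.
rewrite (prestr_sub _ ste); last exact: subIsetl.
by apply: prestr_sub tuf; exact: subIsetr.
Qed.

Canonical germbar_equiv :=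
  EquivRel germbar_rel germbar_rel_refl germbar_rel_sym germbar_rel_trans.

Lemma germ_germbar p q : germ_rel p q -> germbar_rel p q.
Proof.
move=> /asboolP[pq [e [ste che]]]; apply/asboolP; split=> //.
by exists (\val e); [exact: Jbar_J|split=> //; exact: ev_bar_J].
Qed.

Definition range_pt (p : pairs) : spectrum := act (base_dom p).

Lemma spectrumP (chi psi : spectrum) :
  (forall e, ev chi e = true -> ev psi e = true) ->
  (forall e, ev psi e = true -> ev chi e = true) -> chi = psi.
Proof.
move=> h1 h2; apply: val_inj; apply/funext => e; apply/idP/idP.
  exact: h1.
exact: h2.
Qed.

Lemma germbar_range_sub (p q : pairs) (g : J) : Omega (base p) ->
  germbar_rel p q -> ev (range_pt p) g = true -> ev (range_pt q) g = true.
Proof.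
move=> Op /asboolP[pq [eps _ [st /asboolP[e [fs [[fe epsE] che chf]]]]]].
rewrite {}epsE in st.
rewrite /ev /= -/(ev _ _) -/(ev _ _) -pq => chs.
pose h := JI e (JI (Jpre (elt p) g) (Jpre (elt q) g)).
have hE : \val (JI e (Jpre (elt p) g)) =
    Junion (h :: [seq JI f (Jpre (elt p) g) | f <- fs]).
  apply/seteqP; split=> x /=.
    move=> [xe [y xy gy]]; have [[f /= ffs xf]|nx] := pselect (Junion fs x).
      exists (JI f (Jpre (elt p) g)); last by split=> //; exists y.
      by rewrite /= inE; apply/orP; right; apply/mapP; exists f.
    exists h; first by rewrite /= inE eqxx.
    split=> //; split; first by exists y.
    exists y => //; have : prestr (\val (elt p)) (\val e `\` Junion fs) (x, y) by [].
    by rewrite st => -[].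
  move=> [f /=]; rewrite inE => /orP[/eqP->[? []//]|/mapP[k kfs ->] []].
  by move=> /(fe _ kfs).
have [f] : exists2 f, f \in h :: [seq JI f (Jpre (elt p) g) | f <- fs] &
    ev (base p) f = true by apply: Op hE _; rewrite evI che.
rewrite inE => /orP[/eqP->|/mapP[k kfs ->]].
  by rewrite !evI => /andP[_ /andP[]].
by rewrite evI (chf _ kfs).
Qed.

Lemma germbar_range p q : Omega (base p) ->
  germbar_rel p q -> range_pt p = range_pt q.
Proof.
move=> Op pq; have /asboolP[E _] := pq; apply: spectrumP => g.
  exact: germbar_range_sub.
have qp : germbar_rel q p by have := germbar_rel_sym p q; rewrite pq.
by apply: germbar_range_sub qp; rewrite -E.
Qed.

Lemma germ_range p q : germ_rel p q -> range_pt p = range_pt q.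
Proof.
have aux (p' q' : pairs) (g : J) : germ_rel p' q' ->
    ev (range_pt p') g = true -> ev (range_pt q') g = true.
  move=> /asboolP[E [e [st che]]]; rewrite /ev /= -/(ev _ _) -/(ev _ _) -E => ch.
  have : ev (base p') (JI e (Jpre (elt p') g)) = true by rewrite evI che.
  apply: ev_sub => x /= [xe [y xy gy]]; exists y => //.
  have : prestr (\val (elt p')) (\val e) (x, y) by [].
  by rewrite st => -[].
move=> pq; apply: spectrumP => g; first exact: aux.
by apply: aux; have := germ_rel_sym p q; rewrite pq.
Qed.

(* r is germ_equiv or germbar_equiv. Sources and ranges are read off a
   representative (for the independence of the choice, see transf_sourceE and
   the lemmas after it). gmul is the graph of the partial product
   [s, t.chi] [t, chi] = [s t, chi]; it is total on composable pairs by
   gmul_total, and single-valued by germ_mul and germbar_mul. *)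
Section Quotient.
Variable r : equiv_rel pairs.

Definition germs : topologicalType := quotient_topology {eq_quot r}.

Definition germ (p : pairs) : germs := \pi_{eq_quot r} p.

Definition gsource (g : germs) : spectrum := base (repr (g : {eq_quot r})).

Definition grange (g : germs) : spectrum := range_pt (repr (g : {eq_quot r})).

Definition gmul (g h k : germs) : Prop :=
  exists p q m : pairs,
    [/\ g = germ p, h = germ q & k = germ m] /\
    [/\ base p = range_pt q, base m = base q & elt m = IlM (elt p) (elt q)].

Lemma gsourceE p : (forall q q', r q q' -> base q = base q') ->
  gsource (germ p) = base p.
Proof. by apply; have /eqmodP := reprK (\pi_{eq_quot r} p). Qed.

Lemma grangeE p : (forall q q', r q q' -> range_pt q = range_pt q') ->
  grange (germ p) = range_pt p.
Proof. by apply; have /eqmodP := reprK (\pi_{eq_quot r} p). Qed.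

End Quotient.

(* transf_groupoid is defined by ~, transf_groupoid_bar by bar ~; by germ_projE
   below, germ_proj sends the ~-class of a pair to its bar ~-class. *)
Definition transf_groupoid : topologicalType := germs germ_equiv.

Definition transf_groupoid_bar : topologicalType := germs germbar_equiv.

Definition germ_proj (g : transf_groupoid) : transf_groupoid_bar :=
  germ germbar_equiv (repr (g : {eq_quot germ_equiv})).

Lemma germ_projE p : germ_proj (germ germ_equiv p) = germ germbar_equiv p.
Proof.
apply/eqmodP; apply: germ_germbar.
by have /eqmodP := reprK (\pi_{eq_quot germ_equiv} p).
Qed.

Lemma transf_sourceE p : gsource (germ germ_equiv p) = base p.
Proof. by apply: gsourceE => q q' /asboolP[]. Qed.

Lemma transf_rangeE p : grange (germ germ_equiv p) = range_pt p.
Proof. by apply: grangeE; exact: germ_range. Qed.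

Lemma transf_bar_sourceE p : gsource (germ germbar_equiv p) = base p.
Proof. by apply: gsourceE => q q' /asboolP[]. Qed.

Lemma transf_bar_rangeE p : Y `<=` Omega ->
  grange (germ germbar_equiv p) = range_pt p.
Proof.
move=> YO; apply: grangeE => q q'; apply: germbar_range.
by apply: YO; have [] := set_valP (projT2 q).
Qed.

End Germs.

Lemma ev_open (e : J) (b : bool) : open [set chi : spectrum | ev chi e = b].
Proof.
exists [set f : {ptws J -> bool} | f e = b] => //.
have /continuousP H : continuous (fun f : {ptws J -> bool} => f e).
  exact: (@proj_continuous J (fun=> bool) e).
by apply: (H [set b]); exact: discrete_open.
Qed.

Lemma ev_near (chi : spectrum) (e : J) (b : bool) :
  ev chi e = b -> nbhs chi [set psi | ev psi e = b].
Proof. by move=> che; apply: open_nbhs_nbhs; split=> //; exact: ev_open. Qed.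

Lemma ev_near_seq (chi : spectrum) (gs : seq J) :
  ~ (exists2 f, f \in gs & ev chi f = true) ->
  nbhs chi [set psi | forall f, f \in gs -> ev psi f = false].
Proof.
elim: gs => [|f gs IH] ngs.
  by apply: filterS (@filterT _ (nbhs chi) _) => psi _ f; rewrite in_nil.
have /IH H2 : ~ exists2 f, f \in gs & ev chi f = true.
  by move=> [g ggs chg]; apply: ngs; exists g => //; rewrite inE ggs orbT.
have chf : ev chi f = false.
  by apply/negP => h; apply: ngs; exists f; rewrite ?mem_head.
apply: filterS2 (ev_near chf) H2 => psi psf psgs g.
by rewrite inE => /orP[/eqP->//|]; exact: psgs.
Qed.

Lemma Omega_closed : closed Omega.
Proof.
rewrite -openC openE => chi nO.
have /existsNP[e /existsNP[fs]] := nO.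
move=> /not_implyP[eE /not_implyP[che nf]].
apply: filterS2 (ev_near_seq nf) (ev_near che) => psi psf pse Opsi.
by have [f /psf ->] := Opsi e fs eE pse.
Qed.

Lemma Omega_max_Omega : Omega_max `<=` Omega.
Proof.
move=> chi chmax e fs eE che; apply: contrapT => nf.
suff [f ffs [psi]] : exists2 f, f \in fs & exists psi : spectrum,
    ev psi f = true /\ forall g, ev chi g = true -> ev psi g = true.
  move=> [psf chpsi]; apply: nf; exists f => //.
  have /seteqP[_] := chmax psi chpsi; exact.
apply: contrapT => npsi.
have [h che' h0] : exists2 h, ev chi h = true &
    forall f, f \in fs -> \val h `&` \val f = set0.
  move: npsi {eE nf}; elim: fs => [|f fs IH] npsi; first by exists e.
  have [h chh hfs] : exists2 h, ev chi h = true &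
      forall f, f \in fs -> \val h `&` \val f = set0.
    apply: IH => -[g gfs psi]; apply: npsi; exists g => //.
    by rewrite inE gfs orbT.
  suff [k chk kf] : exists2 k, ev chi k = true & \val k `&` \val f = set0.
    exists (JI h k); first by rewrite evI chh.
    move=> g; rewrite inE => /orP[/eqP->|gfs]; apply/seteqP; split=> x //=.
      by move=> [[_ xk] xf]; have : set0 x by rewrite -kf.
    by move=> [[xh _] xg]; have : set0 x by rewrite -(hfs _ gfs).
  apply: contrapT => nk; apply: npsi; exists f; rewrite ?mem_head//.
  have P : is_character ((fun g => `[< exists2 k, ev chi k = true &
      \val k `&` \val f `<=` \val g >]) : {ptws J -> bool}).
    split.
    - by exists e; apply/asboolP; exists e => // x [].
    - move=> g1 g2; apply/asboolP/andP.
        move=> [k chk kg]; split; apply/asboolP; exists k => // x /kg[]//.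
      move=> [/asboolP[k1 ch1 kg1] /asboolP[k2 ch2 kg2]].
      exists (JI k1 k2); first by rewrite evI ch1.
      by move=> x [[x1 x2] xf]; split; [exact: kg1|exact: kg2].
    - move=> g g0; apply/asboolP => -[k chk kg]; apply: nk; exists k => //.
      by apply/seteqP; split=> // x /kg; rewrite g0.
  exists (SigSub (mem_set P)); split; first by apply/asboolP; exists e => // x [].
  by move=> g chg; apply/asboolP; exists g => // x [].
have [_ _ /(_ (JI h e))] := set_valP chi.
rewrite -/(ev _ _) evI che' che => H; suff /H : \val (JI h e) = set0 by [].
apply/seteqP; split=> x //= [xh]; rewrite eE => -[f /= ffs xf].
by have : set0 x by rewrite -(h0 _ ffs).
Qed.

Lemma dOmega_Omega : dOmega `<=` Omega.
Proof.
rewrite /dOmega (closure_id Omega).1; last exact: Omega_closed.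
exact: closureS Omega_max_Omega.
Qed.

(* The germ maps are open. Hence, for fixed s, they embed the copy of
   {chi in Y : chi(s^-1 s) = 1} indexed by s as an open subset; as they commute
   with sources, the quotient topology is the etale topology for which the
   source map is a homeomorphism on each of these subsets. *)
Section Bisections.
Variable Y : set spectrum.

Lemma germ_open_aux (r : equiv_rel (pairs Y)) (U : set (pairs Y)) :
  (forall p q, r p q -> base p = base q /\ exists V : set spectrum,
    [/\ open V, V (base q),
        forall chi, V chi -> Y chi -> ev chi (Jdom (elt q)) = true ->
          ev chi (Jdom (elt p)) = true
      & forall p' q' : pairs Y, elt p' = elt p -> elt q' = elt q ->
          base p' = base q' -> V (base p') -> r p' q']) ->
  open U -> open (@germ Y r @` U).
Proof.
move=> H /sigT_openP oU; rewrite /open /= /quotient_open; apply/sigT_openP => t.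
rewrite openE => chi [/= p Up /eqmodP pq].
have [pqb [V [oV Vq HV1 HV2]]] := H _ _ pq.
case: p Up pq HV1 HV2 pqb => s chi' Up pq HV1 HV2 pqb; have [W oW WU] := oU s.
exists (\val @^-1` (W `&` V)) => /=.
  split; first by exists (W `&` V) => //; exact: openI.
  split=> //; rewrite -[\val chi]/(base (existT _ t chi)) -pqb.
  have : (\val @^-1` W) chi' by rewrite WU.
  by [].
move=> psi [Wpsi Vpsi]; have [Ypsi pt] := set_valP psi.
have ps := HV1 _ Vpsi Ypsi pt.
pose psi' : set_type (Y `&` [set chi | ev chi (Jdom s) = true]) :=
  SigSub (mem_set (conj Ypsi ps)).
exists (existT _ s psi' : pairs Y); last by apply/eqmodP; exact: HV2.
have : (existT _ s @^-1` U) psi' by rewrite -WU.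
by [].
Qed.

Lemma germ_open (U : set (pairs Y)) :
  open U -> open (@germ Y (germ_equiv Y) @` U).
Proof.
apply: germ_open_aux => p q /asboolP[pq [e [st che]]]; split=> //.
exists [set chi | ev chi e = true]; split; [exact: ev_open|by rewrite /= -pq| |].
  move=> chi che' _ cht; have : ev chi (JI e (Jdom (elt q))) by rewrite evI che'.
  apply: ev_sub => x /= [xe [y xy]]; exists y.
  have : prestr (\val (elt q)) (\val e) (x, y) by [].
  by rewrite -st => -[].
move=> p' q' ps qt pq' che'; apply/asboolP; split=> //.
by exists e; rewrite ps qt.
Qed.

Lemma germbar_open (U : set (pairs Y)) : Y `<=` Omega ->
  open U -> open (@germ Y (germbar_equiv Y) @` U).
Proof.
move=> YO; apply: germ_open_aux => p q /asboolP[pq [eps Jeps [st]]].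
move=> /asboolP[e [fs [[fe epsE] che chf]]]; split=> //.
exists ([set chi | ev chi e = true] `&`
        (interior [set chi | forall f, f \in fs -> ev chi f = false])); split.
- by apply: openI; [exact: ev_open|exact: open_interior].
- rewrite -pq; split=> //; apply: ev_near_seq => -[f ffs].
  by rewrite (chf _ ffs).
- move=> chi [/= che' /nbhs_singleton/= chf'] /YO Ochi cht.
  pose h := JI e (Jdom (elt q)).
  have hE : \val h = Junion (JI h (Jdom (elt p)) :: [seq JI f h | f <- fs]).
    apply/seteqP; split=> x /=.
      move=> [xe [y xy]]; have [[f /= ffs xf]|nx] := pselect (Junion fs x).
        exists (JI f h); last by split=> //; split=> //; exists y.
        by rewrite /= inE; apply/orP; right; apply/mapP; exists f.
      exists (JI h (Jdom (elt p))); first by rewrite /= inE eqxx.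
      split; first by split=> //; exists y.
      exists y; have : prestr (\val (elt q)) eps (x, y) by rewrite epsE.
      by rewrite -st => -[].
    by move=> [f /=]; rewrite inE => /orP[/eqP->[]//|/mapP[k kfs ->] []].
  have [f] : exists2 f, f \in JI h (Jdom (elt p)) :: [seq JI f h | f <- fs] &
      ev chi f = true by apply: Ochi hE _; rewrite evI che' cht.
  rewrite inE => /orP[/eqP->|/mapP[k kfs ->]]; rewrite evI; first by case/andP.
  by rewrite (chf' _ kfs).
- move=> p' q' ps qt pq' [/= che' /nbhs_singleton/= chf'].
  apply/asboolP; split=> //; exists eps; rewrite ?ps ?qt//; split=> //.
  by apply/asboolP; exists e, fs.
Qed.

End Bisections.

Section Products.
Variable Y : set spectrum.

Lemma gmul_total (r : equiv_rel (pairs Y)) (g h : germs r) :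
  gsource g = grange h -> exists k, gmul g h k.
Proof.
set p := repr (g : {eq_quot r}); set q := repr (h : {eq_quot r}) => pq.
have ps : ev (base q) (Jdom (IlM (elt p) (elt q))) = true.
  rewrite -(base_dom p) -/(gsource g) pq /grange -/q /range_pt /ev /=.
  congr (_ _); apply: Jval_inj; apply/seteqP; split=> x /=.
    by move=> [z [y xy yz]]; exists y => //; exists z.
  by move=> [y xy [z yz]]; exists z; exists y.
have Yq : Y (base q) by have [] := set_valP (projT2 q).
pose m : pairs Y := existT _ (IlM (elt p) (elt q)) (SigSub (mem_set (conj Yq ps))).
by exists (germ r m), p, q, m; split=> //; rewrite /germ !reprK.
Qed.

Lemma prestr_comp s t s' t' (e f : set C) : partial_bijection t ->
  prestr s e `<=` prestr s' e -> prestr t f `<=` prestr t' f ->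
  prestr (pcomp s t) (f `&` pre t e) `<=` prestr (pcomp s' t') (f `&` pre t e).
Proof.
move=> [t1 _] se tf [x z] [[/= y xy yz] [xf [y' xy' y'e]]].
rewrite -(t1 _ _ _ xy xy') in y'e.
split=> /=; last by split=> //; exists y.
have [ty _] := tf (x, y) (conj xy xf).
by have [sz _] := se (y, z) (conj yz y'e); exists y.
Qed.

Lemma pre_prestr t t' (e f : set C) : prestr t f = prestr t' f ->
  f `&` pre t e = f `&` pre t' e.
Proof.
move=> tf; apply/seteqP; split=> x [xf [y xy ye]]; split=> //; exists y => //.
  by have : prestr t f (x, y) by []; rewrite tf => -[].
by have : prestr t' f (x, y) by []; rewrite -tf => -[].
Qed.

Lemma prestr_compE (s t s' t' : Il) (e f : set C) :
  prestr (\val s) e = prestr (\val s') e ->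
  prestr (\val t) f = prestr (\val t') f ->
  prestr (\val (IlM s t)) (f `&` pre (\val t) e) =
  prestr (\val (IlM s' t')) (f `&` pre (\val t) e).
Proof.
move=> se tf; apply/seteqP; split.
  apply: prestr_comp; rewrite ?se ?tf//.
  exact: Il_partial_bijection (set_valP t).
rewrite (pre_prestr _ tf); apply: prestr_comp; rewrite ?se ?tf//.
exact: Il_partial_bijection (set_valP t').
Qed.

Lemma ev_bar_pre (p : pairs Y) (eps : set C) :
  ev_bar (range_pt p) eps -> ev_bar (base p) (pre (\val (elt p)) eps).
Proof.
have [p1 _] := Il_partial_bijection (set_valP (elt p)).
move=> /asboolP[e [fs [[fe epsE] che chf]]]; apply/asboolP.
exists (Jpre (elt p) e), [seq Jpre (elt p) f | f <- fs]; split=> //; last first.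
  by move=> f /mapP[g gfs ->]; exact: chf gfs.
split; first by move=> f /mapP[g gfs ->] x [y xy yg]; exists y => //; exact: fe yg.
rewrite epsE; apply/seteqP; split=> x /=.
  move=> [y xy [ye yf]]; split; first by exists y.
  move=> [f /= /mapP[g gfs ->] [z xz zg]]; apply: yf; exists g => //.
  by rewrite (p1 _ _ _ xy xz).
move=> [[y xy ye] xf]; exists y => //; split=> // -[f ffs yf]; apply: xf.
exists (Jpre (elt p) f); last by exists y.
by apply/mapP; exists f.
Qed.

Lemma germ_mul (p q m p' q' m' : pairs Y) : germ_rel p p' -> germ_rel q q' ->
  base p = range_pt q -> base m = base q -> elt m = IlM (elt p) (elt q) ->
  base m' = base q' -> elt m' = IlM (elt p') (elt q') -> germ_rel m m'.
Proof.
move=> /asboolP[pp [e [se che]]] /asboolP[qq [f [tf chf]]] pq bm em bm' em'.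
apply/asboolP; split; first by rewrite bm bm'.
exists (JI f (Jpre (elt q) e)); split; first by rewrite em em'; exact: prestr_compE.
by rewrite evI bm chf /=; rewrite pq in che.
Qed.

Lemma germbar_mul (p q m p' q' m' : pairs Y) : germbar_rel p p' -> germbar_rel q q' ->
  base p = range_pt q -> base m = base q -> elt m = IlM (elt p) (elt q) ->
  base m' = base q' -> elt m' = IlM (elt p') (elt q') -> germbar_rel m m'.
Proof.
move=> /asboolP[pp [e Je [se che]]] /asboolP[qq [f Jf [tf chf]]] pq bm em bm' em'.
apply/asboolP; split; first by rewrite bm bm'.
rewrite pq in che; have [Jh chh] := ev_barI chf (ev_bar_pre che).
exists (f `&` pre (\val (elt q)) e) => //; rewrite bm; split=> //.
by rewrite em em'; exact: prestr_compE.
Qed.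

End Products.

(* A homeomorphism compatible with sources, ranges and products (hence also
   with units and inverses). *)
Definition topgroupoid_iso (Y : set spectrum) (r r' : equiv_rel (pairs Y))
    (phi : germs r -> germs r') : Prop :=
  [/\ exists psi : germs r' -> germs r,
        [/\ cancel phi psi, cancel psi phi, continuous phi & continuous psi],
      forall g, gsource (phi g) = gsource g,
      forall g, grange (phi g) = grange g
    & forall g h k, gmul g h k <-> gmul (phi g) (phi h) (phi k)].

End Semigroup.

(* Main.v *)
(** Both groupoids are quotients of the same space of pairs, so the projection is
    an isomorphism as soon as it is injective, i.e. as soon as every
    [bar ~]-related pair over the boundary is [~]-related. At a
    maximal character [chi] this holds without any assumption: if
    [chi (e \ (f_1 u ... u f_n)) = 1] then maximality provides [h_i] with
    [chi h_i = 1] and [h_i] disjoint from [f_i], and the intersection of [e] and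
    the [h_i] is an element of [J] inside [e \ (f_1 u ... u f_n)]. This settles
    (iii). For (ii), two distinct [bar ~]-related germs over the boundary would be
    separated by open sets, while by density of the maximal characters these sets
    share a germ over a nearby maximal character. For (i), boundary pairs are
    compared inside the larger groupoid over [Omega]. *)

Require Import Defs.
From mathcomp Require Import all_boot.
From mathcomp Require Import all_classical topology.

Set Implicit Arguments.
Unset Strict Implicit.
Unset Printing Implicit Defensive.

Local Open Scope classical_set_scope.
Local Open Scope quotient_scope.

Section GermProjection.
Variables (C : lcCategory) (Y : set (spectrum C)).
Implicit Types (chi : spectrum C) (p q : pairs Y).

Lemma germ_eqP p q : germ (germ_equiv Y) p = germ (germ_equiv Y) q <-> germ_rel p q.
Proof. by split=> [/eqmodP|?]; last exact/eqmodP. Qed.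

Lemma germbar_eqP p q :
  germ (germbar_equiv Y) p = germ (germbar_equiv Y) q <-> germbar_rel p q.
Proof. by split=> [/eqmodP|?]; last exact/eqmodP. Qed.

Lemma germ_continuous (r : equiv_rel (pairs Y)) : continuous (germ r).
Proof. exact: (@pi_continuous (pairs Y) {eq_quot r}). Qed.

Lemma germ_surj (r : equiv_rel (pairs Y)) (g : germs r) : exists p, g = germ r p.
Proof. by exists (repr (g : {eq_quot r})); rewrite /germ reprK. Qed.

Lemma base_in p : Y (base p).
Proof. by have [] := set_valP (projT2 p). Qed.

Lemma pairs_exist s chi : Y chi -> ev chi (Jdom s) = true ->
  exists p, elt p = s /\ base p = chi.
Proof.
by move=> Ychi chis; exists (existT _ s (SigSub (mem_set (conj Ychi chis))) : pairs Y).
Qed.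

(** Pairs form a disjoint union over [s], so the preimage of [U] in the copy of index [elt p] is cut
    out by an open set of characters. *)
Lemma germ_near (r : equiv_rel (pairs Y)) p (U : set (germs r)) :
  open U -> U (germ r p) ->
  \forall psi \near base p, forall q, elt q = elt p -> base q = psi -> U (germ r q).
Proof.
move=> oU Up; have /sigT_openP /(_ (elt p)) [W oW WE] : open (germ r @^-1` U).
  by apply: open_comp => // x _; exact: germ_continuous.
case: p Up WE => s chi /= Up WE.
have Wchi : W (\val chi) by have : (\val @^-1` W) chi by rewrite WE.
apply: filterS (open_nbhs_nbhs (conj oW Wchi)).
(* The type of [chi'] depends on [t], so [t] must be replaced by [s] before [WE] applies. *)
move=> psi Wpsi [t chi'] /= ts; case: _ / (esym ts) chi' => chi' E; subst psi.
by have : (\val @^-1` W) chi' by []; rewrite WE.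
Qed.

(** The inverse [psi] re-reads a representative modulo [germ_rel]; [bar_germ] makes the choice
    harmless. Continuity both ways is the universal property of the quotients. Inclusion in [Omega]
    gives well-defined ranges on the coarser classes. *)
Lemma germ_proj_inj_iso : Y `<=` @Omega C ->
  (forall p q, germbar_rel p q -> germ_rel p q) ->
  topgroupoid_iso (germ_proj (Y := Y)).
Proof.
move=> YO bar_germ.
pose psi (g : transf_groupoid_bar Y) : transf_groupoid Y :=
  germ (germ_equiv Y) (repr (g : {eq_quot germbar_equiv Y})).
have psiE p : psi (germ (germbar_equiv Y) p) = germ (germ_equiv Y) p.
  by apply/germ_eqP/bar_germ/germbar_eqP; rewrite /germ reprK.
have phiK : cancel (germ_proj (Y := Y)) psi.
  by move=> g; have [p ->] := germ_surj g; rewrite germ_projE psiE.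
have psiK : cancel psi (germ_proj (Y := Y)).
  by move=> g; have [p ->] := germ_surj g; rewrite psiE germ_projE.
split.
- exists psi; split=> //; apply/quotient_continuous.
    rewrite (_ : _ \o _ = germ (germbar_equiv Y)); first exact: germ_continuous.
    by apply/funext => p; exact: germ_projE.
  rewrite (_ : _ \o _ = germ (germ_equiv Y)); first exact: germ_continuous.
  by apply/funext => p; exact: psiE.
- move=> g; have [p ->] := germ_surj g.
  by rewrite germ_projE transf_sourceE transf_bar_sourceE.
- move=> g; have [p ->] := germ_surj g.
  by rewrite germ_projE transf_rangeE transf_bar_rangeE.
(* The same three pairs witness both products; backwards, injectivity lifts the equations. *)
- move=> g h k; split=> -[p [q [m [[gE hE kE] pqm]]]]; exists p, q, m; split=> //.
    by rewrite gE hE kE !germ_projE.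
  by split; apply: (can_inj phiK); rewrite germ_projE.
Qed.

Lemma iso_germbar_germ p q :
  topgroupoid_iso (germ_proj (Y := Y)) -> germbar_rel p q -> germ_rel p q.
Proof.
move=> [[psi [phiK _ _ _]] _ _ _] /germbar_eqP pq.
by apply/germ_eqP/(can_inj phiK); rewrite !germ_projE.
Qed.

End GermProjection.

Section MaximalCharacters.
Variable C : lcCategory.
Implicit Types (chi : spectrum C) (e f : J (C := C)).

Lemma Omega_max_disjoint chi f : Omega_max chi -> ev chi f = false ->
  exists2 h, ev chi h = true & \val h `&` \val f = set0.
Proof.
move=> chimax chif; apply: contrapT => nh.
(* This is the filter generated by [f] and the filter of [chi]; [nh] keeps the empty set out. It
   contains [f], against maximality of [chi]. *)
have P : is_character ((fun g => `[< exists2 k, ev chi k = true &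
    \val k `&` \val f `<=` \val g >]) : {ptws J (C := C) -> bool}).
  have [[e che] _ _] := set_valP chi; split.
  - by exists e; apply/asboolP; exists e => // x [].
  - move=> g1 g2; apply/asboolP/andP.
      by move=> [k chk kg]; split; apply/asboolP; exists k => // x /kg[].
    move=> [/asboolP[k1 ch1 kg1] /asboolP[k2 ch2 kg2]].
    exists (JI k1 k2); first by rewrite evI ch1.
    by move=> x [[x1 x2] xf]; split; [exact: kg1|exact: kg2].
  - move=> g g0; apply/asboolP => -[k chk kg]; apply: nh; exists k => //.
    by apply/seteqP; split=> // x /kg; rewrite g0.
have sub : [set e | ev chi e = true] `<=`
    [set e | ev (SigSub (mem_set P)) e = true].
  by move=> g chg; apply/asboolP; exists g => // x [].
have /seteqP[_ /(_ f)] := chimax _ sub.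
have [[e che] _ _] := set_valP chi.
rewrite /= chif => H; suff : false = true by [].
by apply: H; apply/asboolP; exists e => // x [].
Qed.

Lemma Omega_max_ev_bar chi (eps : set C) : Omega_max chi ->
  ev_bar chi eps = true -> exists2 h, ev chi h = true & \val h `<=` eps.
Proof.
move=> chimax /asboolP[e [fs [[_ ->] che chf]]].
elim: fs chf => [|f fs IH] chf.
  by exists e => // x xe; split=> // -[].
have [|h chh hfs] := IH; first by move=> g gfs; apply: chf; rewrite inE gfs orbT.
have [k chk kf] := Omega_max_disjoint chimax (chf _ (mem_head _ _)).
exists (JI h k); first by rewrite evI chh.
move=> x [/hfs[xe xfs] xk]; split=> // -[g /=]; rewrite inE => /orP[/eqP->|gfs] xg.
  by have : set0 x by rewrite -kf.
by apply: xfs; exists g.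
Qed.

Lemma Omega_max_germbar_germ (Y : set (spectrum C)) (p q : pairs Y) :
  Omega_max (base p) -> germbar_rel p q -> germ_rel p q.
Proof.
move=> pmax /asboolP[pq [eps _ [pqeps cheps]]]; apply/asboolP; split=> //.
have [h chh heps] := Omega_max_ev_bar pmax cheps.
by exists h; split=> //; exact: prestr_sub pqeps.
Qed.

End MaximalCharacters.

Lemma hausdorff_germbar_germ (C : lcCategory) (p q : pairs (@dOmega C)) :
  hausdorff_space (transf_groupoid (@dOmega C)) ->
  germbar_rel p q -> germ_rel p q.
Proof.
rewrite open_hausdorff => H pq; apply/germ_eqP; apply: contrapT => /eqP /H.
move=> [[U V] /= [/set_mem Up /set_mem Vq] [oU oV /eqP UV0]].
have /asboolP[pqb [eps Jeps [pqeps /asboolP[e [fs [epsE che chf]]]]]] := pq.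
have nchf : ~ exists2 f, f \in fs & ev (base p) f = true.
  by move=> [f ffs]; rewrite chf.
have Vnear := germ_near oV Vq; rewrite -pqb in Vnear.
have qdom : ev (base p) (Jdom (elt q)) = true by rewrite pqb base_dom.
(* Near [base p] both pairs can be moved to [psi], staying in [U] and [V] and related through the
   same [eps]. *)
have N : nbhs (base p) [set psi |
   [/\ forall p', elt p' = elt p -> base p' = psi -> U (germ _ p'),
       forall q', elt q' = elt q -> base q' = psi -> V (germ _ q') &
       [/\ ev psi (Jdom (elt p)) = true, ev psi (Jdom (elt q)) = true,
           ev psi e = true & forall f, f \in fs -> ev psi f = false]]].
  near=> psi; split; [| |split]; near: psi => //.
  - exact: germ_near.
  - exact: ev_near (base_dom p).
  - exact: ev_near qdom.
  - exact: ev_near che.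
  - exact: ev_near_seq.
(* Density supplies a maximal [psi], where the two moved germs coincide and so lie in both [U] and
   [V]. *)
have clp : closure (@Omega_max C) (base p) := base_in p.
have [psi [psimax [Upsi Vpsi [psip psiq psie psif]]]] := clp _ N.
have Ypsi : dOmega psi by exact: subset_closure.
have [p' [p'elt p'base]] := pairs_exist Ypsi psip.
have [q' [q'elt q'base]] := pairs_exist Ypsi psiq.
have : set0 (germ (germ_equiv (@dOmega C)) p').
  rewrite -UV0; split; first exact: Upsi.
  suff /germ_eqP -> : germ_rel p' q' by exact: Vpsi.
  apply: Omega_max_germbar_germ; first by rewrite p'base.
  apply/asboolP; split; first by rewrite p'base q'base.
  exists eps => //; rewrite p'elt q'elt p'base; split=> //.
  by apply/asboolP; exists e, fs.
by [].
Unshelve. all: by end_near.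
Qed.

(** Pairs over [Y] and over [Z] have different types, but both relations see only [elt] and [base],
    so they transfer to copies over [Z]. *)
Lemma germbar_germ_subset (C : lcCategory) (Y Z : set (spectrum C)) :
  Y `<=` Z ->
  (forall p q : pairs Z, germbar_rel p q -> germ_rel p q) ->
  forall p q : pairs Y, germbar_rel p q -> germ_rel p q.
Proof.
move=> YZ H p q /asboolP; have Zp := YZ _ (base_in p); have Zq := YZ _ (base_in q).
have [p' [p'elt p'base]] := pairs_exist Zp (base_dom p).
have [q' [q'elt q'base]] := pairs_exist Zq (base_dom q).
rewrite -p'elt -q'elt -p'base -q'base => /asboolP /H /asboolP.
by rewrite p'elt q'elt p'base q'base => /asboolP.
Qed.

Theorem lemma3p5 (C : lcCategory) :
  topgroupoid_iso (germ_proj (Y := @Omega C)) \/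
  hausdorff_space (transf_groupoid (@dOmega C)) \/
  @dOmega C = @Omega_max C ->
  topgroupoid_iso (germ_proj (Y := @dOmega C)).
Proof.
move=> H; apply: germ_proj_inj_iso; first exact: dOmega_Omega.
case: H => [iso|[haus|dmax]] p q.
- apply: germbar_germ_subset p q; first exact: dOmega_Omega.
  by move=> p q; exact: iso_germbar_germ.
- exact: hausdorff_germbar_germ.
- by apply: Omega_max_germbar_germ; rewrite -dmax; exact: base_in.
Qed.
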